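(* Let $n\geq 1$ and $k\geq 3$ be integers, let $k_1,\ldots,k_{2n+1}$ be positive integers, and let $G$ be the clique expansion $C_{2n+1}[k_1,\ldots,k_{2n+1}]$. Then $G$ is $k$-colorable if and only if both of the following hold, where indices are taken modulo $2n+1$: (i) $k_i+k_{i+1}\leq k$ for every $i\in\{1,\ldots,2n+1\}$; (ii) $\sum_{i=1}^{2n+1} k_i\leq nk$.
   Context: For $p\geq 3$ and positive integers $k_1,\ldots,k_p$, the clique expansion $C_p[k_1,\ldots,k_p]$ is the graph obtained from the cycle $C_p$ with vertices $v_1,\ldots,v_p$ (in cyclic order) by replacing each $v_i$ with a complete graph $K^i$ on $k_i$ vertices, where two vertices in distinct cliques $K^i,K^j$ are adjacent if and only if $v_iv_j$ is an edge of the cycle (i.e. $j\equiv i\pm1 \pmod p$), in which case all edges between $K^i$ and $K^j$ are present. A graph is $k$-colorable if its vertices can be colored with $k$ colors so that adjacent vertices receive distinct colors. *)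

(* Defs.v *)
From mathcomp Require Import all_boot.
Set Implicit Arguments.
Unset Strict Implicit.
Unset Printing Implicit Defensive.

(* Graphs are symmetric irreflexive relations on a finite type of vertices. *)

Definition colorable (T : finType) (e : rel T) (k : nat) : Prop :=
  exists c : T -> 'I_k, forall x y : T, e x y -> c x != c y.

(* The vertices 0, ..., p-1 stand for v_1, ..., v_p; ordS is the cyclic
   successor i |-> i + 1 mod p. This is the cycle C_p for p >= 3. *)
Definition cycle_adj (p : nat) : rel 'I_p :=
  [rel i j | (j == ordS i) || (i == ordS j)].

(* A vertex of C_p[k_1, ..., k_p] is a pair (i, a) with a < k_i: the a-th
   vertex of the clique K^i. *)
Definition clique_vertex (p : nat) (kk : 'I_p -> nat) : finType :=
  {i : 'I_p & 'I_(kk i)}.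

Definition clique_expansion (p : nat) (kk : 'I_p -> nat) :
    rel (clique_vertex kk) :=
  [rel x y | if tag x == tag y then x != y else cycle_adj (tag x) (tag y)].

Lemma clique_expansion_sym (p : nat) (kk : 'I_p -> nat) :
  symmetric (@clique_expansion p kk).
Proof.
move=> x y; rewrite /clique_expansion /= (eq_sym (tag x)) (eq_sym x).
by case: ifP => // _; rewrite /cycle_adj /= orbC.
Qed.

Lemma clique_expansion_irr (p : nat) (kk : 'I_p -> nat) :
  irreflexive (@clique_expansion p kk).
Proof. by move=> x; rewrite /clique_expansion /= !eqxx. Qed.

(* Main.v *)
(* If [c] is a proper colouring, two consecutive cliques form one clique, and a
   colour class meets every clique in at most one vertex and projects to an
   independent set of the odd cycle, hence has at most [n] elements.
   Conversely, colour the clique [K^i] by the interval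
   [x_i, x_i + 1, ..., x_i + k_i - 1] modulo [k].  Consecutive cliques get
   disjoint colours as soon as [x_(i+1) - x_i] lies between [k_i] and
   [k - k_(i+1)], and the colouring closes up around the cycle if
   [x_(2n+1) - x_0 = n k].  Such [x_i] exist because [n k] lies between the
   sum of the lower bounds and the sum of the upper bounds on the increments. *)
Require Import Defs.
From mathcomp Require Import all_boot zify.
Set Implicit Arguments.
Unset Strict Implicit.
Unset Printing Implicit Defensive.

Lemma ordS_neq (p : nat) (i : 'I_p) : 1 < p -> ordS i != i.
Proof.
move=> p_gt1; apply/eqP => /(congr1 val) /=.
have [lt_ip|] := ltnP i.+1 p; first by rewrite modn_small //; lia.
have := ltn_ord i => ? ?; have -> : i.+1 = p by lia.
by rewrite modnn; lia.
Qed.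

(** The shift of [S] by the injective [ordS] is disjoint from [S] and has the same size. *)
Lemma cycle_independent_card (p : nat) (S : {set 'I_p}) :
  {in S &, forall i j, j != ordS i} -> #|S|.*2 <= p.
Proof.
move=> indS.
have dis : [disjoint S & [set ordS i | i in S]].
  rewrite disjoints_subset; apply/subsetP => j Sj; rewrite inE.
  by apply/negP => /imsetP[i Si] /eqP; apply/negP; apply: indS.
have := max_card (S :|: [set ordS i | i in S]); rewrite card_ord.
rewrite cardsU (eqP (_ : S :&: _ == set0)) ?setI_eq0 // cards0 subn0.
by rewrite card_imset ?addnn //; apply: can_inj (@ordSK p).
Qed.

Section Colouring.
Variables (p k : nat) (kk : 'I_p -> nat).
Variable c : clique_vertex kk -> 'I_k.
Hypothesis c_proper : forall x y, clique_expansion x y -> c x != c y.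

Lemma proper_clique (x y : clique_vertex kk) :
  tag x = tag y -> c x = c y -> x = y.
Proof.
move=> eq_t eq_c; apply/eqP; apply: contraT => ne_xy.
have := @c_proper x y; rewrite /clique_expansion /= eq_t eqxx => /(_ ne_xy).
by rewrite eq_c eqxx.
Qed.

Lemma proper_consecutive (x y : clique_vertex kk) :
  1 < p -> tag y = ordS (tag x) -> c x != c y.
Proof.
move=> p_gt1 eq_t; apply: c_proper; rewrite /clique_expansion /= eq_t.
by rewrite eq_sym (negPf (ordS_neq _ p_gt1)) /cycle_adj /= eqxx.
Qed.

Lemma consecutive_cliques_le (i : 'I_p) : 1 < p -> kk i + kk (ordS i) <= k.
Proof.
move=> p_gt1.
pose v (j : 'I_p) (a : 'I_(kk j)) : clique_vertex kk := Tagged _ a.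
pose h (z : 'I_(kk i) + 'I_(kk (ordS i))) :=
  match z with inl a => c (v _ a) | inr b => c (v _ b) end.
have inj_v (j : 'I_p) (a b : 'I_(kk j)) : c (v _ a) = c (v _ b) -> a = b.
  move=> /(@proper_clique (v _ a) (v _ b) (erefl _)) /eqP.
  by rewrite /v eq_Tagged => /eqP.
have ne_v (a : 'I_(kk i)) (b : 'I_(kk (ordS i))) : c (v _ a) <> c (v _ b).
  by apply/eqP; apply: proper_consecutive.
have inj_h : injective h.
  move=> [a|a] [b|b] /= => [/inj_v->|/ne_v|/esym/ne_v|/inj_v->] //.
by have := leq_card h inj_h; rewrite card_sum !card_ord.
Qed.

Lemma colour_class_card (col : 'I_k) :
  1 < p -> #|[set x | c x == col]|.*2 <= p.
Proof.
move=> p_gt1; rewrite -(card_in_imset (f := tag)); last first.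
  move=> x y; rewrite !inE => /eqP cx /eqP cy eq_t.
  by apply: proper_clique; rewrite ?cx ?cy.
apply: cycle_independent_card => i j /imsetP[x + ->] /imsetP[y + ->].
rewrite !inE => /eqP cx /eqP cy; apply/eqP => eq_t.
by have := proper_consecutive p_gt1 eq_t; rewrite cx cy eqxx.
Qed.

Lemma sum_cliques_le : 1 < p -> \sum_(i < p) kk i <= p./2 * k.
Proof.
move=> p_gt1.
have -> : \sum_(i < p) kk i = #|clique_vertex kk|.
  rewrite card_tagged sumnE big_map big_enum /=.
  by apply: eq_bigr => i _; rewrite card_ord.
(* Count the vertices colour by colour: each of the [k] classes has at most [p./2] elements. *)
rewrite -sum1_card (partition_big c predT) //=.
rewrite mulnC -[k in k * _]card_ord -sum_nat_const; apply: leq_sum => col _.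
rewrite sum1_card -cardsE; apply: leq_trans (half_leq (colour_class_card col p_gt1)).
by rewrite doubleK.
Qed.

End Colouring.

(* [x i] is the smaller of the position reached from [x 0 = 0] with maximal
   increments and the one from which minimal increments lead to [x p = m k]. *)
Lemma cyclic_interval_starts (p m k : nat) (f : nat -> nat) :
    (forall i, f i + f i.+1 <= k) -> f p = f 0 ->
    \sum_(0 <= i < p) f i <= m * k ->
    m * k + \sum_(0 <= i < p) f i <= p * k ->
  exists x : nat -> nat,
    [/\ x 0 = 0, x p = m * k &
        forall i, i < p -> x i + f i <= x i.+1 /\ x i.+1 + f i.+1 <= x i + k].
Proof.
move=> fk fp le_lo le_hi.
(* Neither subtraction truncates in the range used, by [leU] and [leV]. *)
pose U i := i * k - \sum_(0 <= j < i) f j.+1.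
pose V i := m * k - \sum_(i <= j < p) f j.
have leU i : \sum_(0 <= j < i) f j.+1 <= i * k.
  elim: i => [|i IHi]; first by rewrite big_geq.
  by rewrite big_nat_recr //= mulSn; have := fk i; lia.
have leV i : i <= p -> \sum_(i <= j < p) f j <= m * k.
  by move=> le_ip; move: le_lo; rewrite (big_cat_nat (leq0n i) le_ip) /=; lia.
have U_S i : U i.+1 + f i.+1 = U i + k.
  rewrite /U big_nat_recr //=; have := leU i.+1; have := leU i.
  by rewrite big_nat_recr //= mulSn; lia.
have V_S i : i < p -> V i.+1 = V i + f i.
  move=> lt_ip; rewrite /V (big_ltn lt_ip).
  by have := leV _ (ltnW lt_ip); rewrite (big_ltn lt_ip); lia.
have sumS : \sum_(0 <= j < p) f j.+1 = \sum_(0 <= j < p) f j.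
  apply: (@addnI (f 0)); rewrite -big_nat_recl // big_nat_recr //= fp; lia.
(* The increments of [U] and [V] all lie between [f i] and [k - f i.+1], and the minimum inherits
   both bounds. At [p] it is [V p = m * k], since [le_hi] gives [m * k <= U p]. *)
exists (fun i => minn (U i) (V i)); split=> [||i lt_ip].
- by rewrite /U mul0n sub0n min0n.
- by rewrite /V (big_geq (leqnn p)) subn0 /U sumS; lia.
- by have := U_S i; have := V_S i lt_ip; have := fk i; lia.
Qed.

Lemma modn_neq (k a b : nat) : a < b -> b < a + k -> a %% k != b %% k.
Proof.
move=> lt_ab lt_bk; rewrite eq_sym eqn_mod_dvd ?(ltnW lt_ab) //.
by apply/negP => /dvdn_leq; lia.
Qed.

Lemma interval_colouring (p m k : nat) (kk : 'I_p -> nat) :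
    0 < p -> 0 < k -> (forall i, kk i + kk (ordS i) <= k) ->
    \sum_(i < p) kk i <= m * k -> m * k + \sum_(i < p) kk i <= p * k ->
  colorable (@clique_expansion p kk) k.
Proof.
move=> p_gt0 k_gt0 hkk le_lo le_hi.
(* The [p]-periodic extension of [kk] to all naturals. *)
pose f j := kk (Ordinal (ltn_pmod j p_gt0)).
have fE j (i : 'I_p) : j %% p = i -> f j = kk i.
  by move=> eq_ji; congr kk; apply: val_inj.
have fi (i : 'I_p) : f i = kk i by apply: fE; rewrite modn_small.
have fiS (i : 'I_p) : f i.+1 = kk (ordS i) by apply: fE.
have sum_f : \sum_(0 <= j < p) f j = \sum_(i < p) kk i.
  by rewrite big_mkord; apply: eq_bigr => i _.
have [j|||| x [x0 xp x_step]] := @cyclic_interval_starts p m k f.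
- pose i := Ordinal (ltn_pmod j p_gt0).
  rewrite (fE j i) // (fE j.+1 (ordS i)) //=.
  by rewrite -[in RHS]addn1 modnDml addn1.
- by congr kk; apply: val_inj; rewrite /= modnn mod0n.
- by rewrite sum_f.
- by rewrite sum_f.
pose c (v : clique_vertex kk) := Ordinal (ltn_pmod (x (tag v) + tagged v) k_gt0).
have c_ordS (v w : clique_vertex kk) : tag w = ordS (tag v) -> c v != c w.
  case: v w => [i a] [j b] /= eq_j; subst j; rewrite -val_eqE /=.
  have [lo hi] := x_step i (ltn_ord i).
  have lt_a := ltn_ord a; have lt_b := ltn_ord b.
  (* Only [i = p - 1] wraps around; there [x 0 = 0] and [x p = m * k] agree modulo [k]. *)
  have -> : (x (i.+1 %% p) + b) %% k = (x i.+1 + b) %% k.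
    have [lt_ip|le_pi] := ltnP i.+1 p; first by rewrite (modn_small lt_ip).
    have -> : i.+1 = p by have := ltn_ord i; lia.
    by rewrite modnn x0 xp modnMDl.
  by rewrite fi fiS in lo hi; apply: modn_neq; lia.
exists c => v w; rewrite /clique_expansion /=; case: eqP => [|_ /orP[]/eqP].
(* Inside one clique the offsets differ by less than [kk i <= k]. *)
- case: v w => [i a] [j b] /= eq_ij; subst j; rewrite eq_Tagged -!val_eqE /=.
  have := ltn_ord a; have := ltn_ord b; have := hkk i.
  by case: (ltngtP a b) => // ? ? ? ? _; [|rewrite eq_sym]; apply: modn_neq; lia.
- exact: c_ordS.
- by rewrite eq_sym; apply: c_ordS.
Qed.

Theorem theorem1p4 (n k : nat) (kk : 'I_(2 * n + 1) -> nat)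
    (hn : 1 <= n) (hk : 3 <= k) (hkk : forall i, 0 < kk i) :
  colorable (@clique_expansion (2 * n + 1) kk) k <->
  (forall i : 'I_(2 * n + 1), kk i + kk (ordS i) <= k) /\
  \sum_(i < 2 * n + 1) kk i <= n * k.
Proof.
have p_gt1 : 1 < 2 * n + 1 by lia.
split=> [[c c_proper]|[le_pair le_sum]].
  split=> [i|]; first exact: consecutive_cliques_le c_proper i p_gt1.
  have := sum_cliques_le c_proper p_gt1.
  by have -> : (2 * n + 1)./2 = n by lia.
(* With [m = n], the last bound follows from (ii): [n * k] plus the sum is at most [2 * n * k]. *)
by apply: (@interval_colouring _ n) => //; nia.
Qed.
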